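(* Let $\dim(\mathcal{X})<\infty$. Then for $\mathcal{T}=(T_1,\ldots,T_d),\ \mathcal{S}=(S_1,\ldots,S_d)\in \mathcal{Z}$, $$G_+(\mathcal{T},\mathcal{S})=\frac{1}{w_p(\mathcal{T})^{p-1}}\max\{\mu:\mu\in C_p\}\quad\text{and}\quad G_-(\mathcal{T},\mathcal{S})=\frac{1}{w_p(\mathcal{T})^{p-1}}\min\{\mu:\mu\in C_p\},$$ where $$C_p=\bigg\{\sum_{i=1}^d\Re\Big(\overline{x^*(T_ix)}|x^*(T_ix)|^{p-2}x^*(S_ix)\Big):(x,x^* )\in M_{w_p(\mathcal{T})},\ x\in E_{\mathcal{X}},\ x^*\in E_{\mathcal{X}^*}\bigg\}.$$
   Context: $\mathcal{X}$ is a Banach space over $\mathbb{F}$ ($\mathbb{R}$ or $\mathbb{C}$) with dual $\mathcal{X}^*$. For a normed space $\mathcal{Y}$, $S_{\mathcal{Y}}$ is its unit sphere and $E_{\mathcal{Y}}$ the set of extreme points of its closed unit ball. $\mathcal{L}(\mathcal{X})$ is the space of bounded linear operators on $\mathcal{X}$; $\Pi=\{(x,x^* ): x\in S_{\mathcal{X}},\ x^*\in S_{\mathcal{X}^*},\ x^*(x)=1\}$. Standing assumption: the numerical radius $w(T)=\sup\{|x^*(Tx)|:(x,x^* )\in\Pi\}$ is a norm on $\mathcal{L}(\mathcal{X})$ (automatic if $\mathbb{F}=\mathbb{C}$). Fix an integer $d\ge 1$ and $1<p<\infty$. The joint numerical radius of $\mathcal{T}=(T_1,\ldots,T_d)\in\mathcal{L}(\mathcal{X})^d$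 is $w_p(\mathcal{T})=\sup\{(\sum_{i=1}^d|x^*(T_ix)|^p)^{1/p}:(x,x^* )\in\Pi\}$, and $\mathcal{Z}=(\mathcal{L}(\mathcal{X})^d,w_p(\cdot))$. $M_{w_p(\mathcal{T})}=\{(x,x^* )\in\Pi:(\sum_{i=1}^d|x^*(T_ix)|^p)^{1/p}=w_p(\mathcal{T})\}$. $\Re$ denotes real part. The one-sided Gateaux derivatives in $\mathcal{Z}$ are $G_{\pm}(\mathcal{T},\mathcal{S})=\lim_{t\to0\pm}\frac{w_p(\mathcal{T}+t\mathcal{S})-w_p(\mathcal{T})}{t}$ ($t$ real). Convention: $\overline{a}|a|^{p-2}$ means $0$ when $a=0$. *)

(* Defs.v *)
From mathcomp Require Import all_boot all_order all_algebra.
From mathcomp Require Import all_classical all_reals all_analysis.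
From mathcomp Require Import complex.

Set Implicit Arguments.
Unset Strict Implicit.
Unset Printing Implicit Defensive.

Import Order.TTheory GRing.Theory Num.Theory.
Import numFieldNormedType.Exports.

Local Open Scope classical_set_scope.
Local Open Scope ring_scope.

Inductive scalar_choice := real_scalars | complex_scalars.

Definition scalar_field (R : realType) (F : scalar_choice) : numFieldType :=
  match F with
  | real_scalars => R
  | complex_scalars => R[i]
  end.

Definition scalar_re (R : realType) (F : scalar_choice) : scalar_field R F -> R :=
  match F with
  | real_scalars => fun z => z
  | complex_scalars => fun z => complex.Re z
  end.

Definition scalar_conj (R : realType) (F : scalar_choice) :
    scalar_field R F -> scalar_field R F :=
  match F with
  | real_scalars => fun z => z
  | complex_scalars => fun z => conjc z
  end.

Definition of_real (R : realType) (F : scalar_choice) : R -> scalar_field R F :=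
  match F with
  | real_scalars => fun r => r
  | complex_scalars => fun r => real_complex R r
  end.
Arguments of_real {R F} r.

(* Norms over R[i] are valued in R[i] (in its nonnegative reals), so
   [scalar_re] turns `|x| into an element of R. *)
Definition rnorm (R : realType) (F : scalar_choice)
  (V : normedModType (scalar_field R F)) (x : V) : R := scalar_re `|x|.

Section FunctionalAnalysis.
Variables (R : realType) (F : scalar_choice).
Local Notation K := (scalar_field R F).

Definition finite_dimensional (V : lmodType K) : Prop :=
  exists (n : nat) (e : 'I_n -> V),
    forall v, exists c : 'I_n -> K, v = \sum_(i < n) c i *: e i.

Definition bounded_operators (V W : normedModType K) : set (V -> W) :=
  [set f | linear f /\ continuous f].
Arguments bounded_operators : clear implicits.

(* When K is R[i], 0 < t forces t to be real. *)
Definition extreme_points (V : lmodType K) (A : set V) : set V :=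
  [set x | A x /\ forall (y z : V) (t : K), A y -> A z -> 0 < t -> t < 1 ->
             x = t *: y + (1 - t) *: z -> y = x /\ z = x].

Definition is_norm_on (V : lmodType K) (L : set V) (N : V -> R) : Prop :=
  [/\ forall u, L u -> 0 <= N u,
      forall u, L u -> N u = 0 -> u = 0,
      forall (a : K) u, L u -> N (a *: u) = rnorm (a : K^o) * N u
    & forall u v, L u -> L v -> N (u + v) <= N u + N v].

Definition is_maximum (A : set R) (m : R) : Prop := A m /\ ubound A m.

Definition is_minimum (A : set R) (m : R) : Prop := A m /\ lbound A m.

Variable X : normedModType K.

Definition unit_ball : set X := [set x | rnorm x <= 1].

Definition unit_sphere : set X := [set x | rnorm x = 1].

Definition dual_space : set (X -> K^o) := bounded_operators X K^o.

Definition dual_norm (f : X -> K^o) : R :=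
  sup [set rnorm (f x) | x in unit_ball].

Definition dual_unit_ball : set (X -> K^o) :=
  [set f | dual_space f /\ dual_norm f <= 1].

Definition dual_unit_sphere : set (X -> K^o) :=
  [set f | dual_space f /\ dual_norm f = 1].

Definition Pi_set : set (X * (X -> K^o)) :=
  [set xf | [/\ unit_sphere xf.1, dual_unit_sphere xf.2 & xf.2 xf.1 = 1]].

Definition numerical_radius (T : X -> X) : R :=
  sup [set rnorm (xf.2 (T xf.1)) | xf in Pi_set].

Variable d : nat.
Implicit Types (p : R) (T S : 'I_d -> X -> X).

Definition joint_value p T (xf : X * (X -> K^o)) : R :=
  (\sum_(i < d) rnorm (xf.2 (T i xf.1)) `^ p) `^ p^-1.

Definition joint_radius p T : R := sup [set joint_value p T xf | xf in Pi_set].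

Definition joint_attainment p T : set (X * (X -> K^o)) :=
  [set xf | Pi_set xf /\ joint_value p T xf = joint_radius p T].

(* The convention that conj a * |a| ^ (p - 2) is 0 at a = 0 holds because
   [scalar_conj] fixes 0 and [powR] is total. *)
Definition C_set p T S : set R :=
  [set \sum_(i < d)
         scalar_re (scalar_conj (xf.2 (T i xf.1) : K)
                    * of_real (rnorm (xf.2 (T i xf.1)) `^ (p - 2%:R))
                    * xf.2 (S i xf.1))
  | xf in [set xf | [/\ joint_attainment p T xf,
                        extreme_points unit_ball xf.1
                      & extreme_points dual_unit_ball xf.2]]].

Definition gateaux_quotient p T S (t : R) : R :=
  (joint_radius p (T + (of_real t : K) *: S) - joint_radius p T) / t.

Definition is_Gplus p T S (l : R) : Prop :=
  gateaux_quotient p T S t @[t --> 0^'+] --> l.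

Definition is_Gminus p T S (l : R) : Prop :=
  gateaux_quotient p T S t @[t --> 0^'-] --> l.

End FunctionalAnalysis.

Arguments bounded_operators {R F} V W _.
Arguments numerical_radius {R F X} T.

(* Main.v *)
Require Import Defs.
From mathcomp Require Import all_boot all_order all_algebra.
From mathcomp Require Import all_classical all_reals all_analysis.
From mathcomp Require Import complex ring lra.
Import Order.TTheory GRing.Theory Num.Theory.
Import numFieldNormedType.Exports.
Local Open Scope classical_set_scope.
Local Open Scope ring_scope.

Set Implicit Arguments.
Unset Strict Implicit.
Unset Printing Implicit Defensive.

(** The p-th power of the joint numerical radius of T + s S is the maximum, over
the pairs (x, f) of a vector and a functional of norm 1 with f x = 1, of the
power sum h_s (x, f), the sum over i of |f (T_i x) + s f (S_i x)|^p.

In finite dimension these pairs form a compact set ([Pi_coords_compact]), and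
h_s is continuous in the pair and convex in s. Its right derivative at s = 0 is
p times the expression that defines [C_set] ([pencil_sum_derivative]). The
right derivative at 0 of a maximum of such functions is the largest derivative
among the maximisers of h_0 ([danskin]). Taking p-th roots yields the formula
for G_+ with the maximum over all attaining pairs.

It remains to see that this maximum is reached at a pair with both components
extreme. The power sum is convex in x and convex in f, and the pairs with
f x = 1 form a face in either variable since 1 is an extreme point of the scalar
disc. If x is a proper convex combination of y and z, and (x, f) maximises h_0
and then the derivative, convexity turns both maximality inequalities for y and
z into equalities, so that (y, f) and (z, f) are maximisers of the same kind
([steep_face]); likewise for f. On the compact set of these maximisers, choose a
pair of greatest Euclidean length in coordinates. Strict convexity of that
length makes both of its components extreme ([extreme_of_face]).

The formula for G_- is the one for G_+ applied to - S, since passing from S to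
- S negates both [C_set] and, up to reflection of s, the difference quotients. *)

(** * Real and complex scalars *)

Lemma closed_sublevel (R : realType) (Z : topologicalType) (f : Z -> R) (C : R) :
  continuous f -> closed [set z | f z <= C].
Proof.
move=> fc; apply: (@preimage_closed _ _ f [set x | x <= C]); last exact: closed_le.
by move=> z _; exact: fc.
Qed.

Section Scalars.
Variables (R : realType) (F : scalar_choice).
Local Notation K := (scalar_field R F).

Definition scalar_im : K -> R :=
  match F as F' return scalar_field R F' -> R with
  | real_scalars => fun=> 0
  | complex_scalars => fun z => complex.Im z
  end.

(** The imaginary unit, or 0 over the reals, so that [scalarE] covers both fields. *)
Definition scalar_i : K :=
  match F as F' return scalar_field R F' with
  | real_scalars => 0
  | complex_scalars => Complex 0 1
  end.

Lemma scalarE (z : K) : z = of_real (scalar_re z) + scalar_i * of_real (scalar_im z).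
Proof.
rewrite /scalar_im /scalar_i; move: z; case: F => z /=; first by rewrite mul0r addr0.
exact: complexE.
Qed.

Lemma of_realD (r s : R) : of_real (r + s) = of_real r + of_real s :> K.
Proof. by case: F => //=; rewrite rmorphD. Qed.

Lemma of_realM (r s : R) : of_real (r * s) = of_real r * of_real s :> K.
Proof. by case: F => //=; rewrite rmorphM. Qed.

Lemma of_realN (r : R) : of_real (- r) = - of_real r :> K.
Proof. by case: F => //=; rewrite rmorphN. Qed.

Lemma of_real0 : of_real 0 = 0 :> K.
Proof. by case: F => //=; rewrite rmorph0. Qed.

Lemma of_real1 : of_real 1 = 1 :> K.
Proof. by case: F => //=; rewrite rmorph1. Qed.

Lemma of_realB (r s : R) : of_real (r - s) = of_real r - of_real s :> K.
Proof. by rewrite of_realD of_realN. Qed.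

Lemma of_real_le (r s : R) : ((of_real r : K) <= of_real s) = (r <= s).
Proof. by case: F => //=; rewrite lecR. Qed.

Lemma of_real_lt (r s : R) : ((of_real r : K) < of_real s) = (r < s).
Proof. by case: F => //=; rewrite ltcR. Qed.

Lemma scalar_re_of_real (r : R) : scalar_re (of_real r : K) = r.
Proof. by case: F. Qed.

Lemma scalar_im_of_real (r : R) : scalar_im (of_real r : K) = 0.
Proof. by rewrite /scalar_im; case: F. Qed.

Lemma of_real_ge0 (z : K) : 0 <= z -> of_real (scalar_re z) = z.
Proof.
case: F z => //= z z0; apply: RRe_real; exact: ger0_real.
Qed.

Lemma scalar_reD (y z : K) : scalar_re (y + z) = scalar_re y + scalar_re z.
Proof. by case: F y z => //= -[a b] [c d]. Qed.

Lemma scalar_imD (y z : K) : scalar_im (y + z) = scalar_im y + scalar_im z.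
Proof.
by rewrite /scalar_im; case: F y z => //= [|[a b] [c d]//]; rewrite addr0.
Qed.

Lemma scalar_reZ (r : R) (z : K) : scalar_re (of_real r * z) = r * scalar_re z.
Proof. by case: F z => //= -[a b] /=; rewrite mul0r subr0. Qed.

Lemma scalar_imZ (r : R) (z : K) : scalar_im (of_real r * z) = r * scalar_im z.
Proof.
by rewrite /scalar_im; case: F z => //= [|[a b]] /=; rewrite ?mulr0// mul0r addr0.
Qed.

(** Real form of the summands of [C_set]: the weighted Euclidean inner product of
[a] and [b], the same for both scalar fields. *)
Lemma scalar_re_weighted (a b : K) (r : R) :
  scalar_re (scalar_conj a * of_real r * b) =
  r * (scalar_re a * scalar_re b + scalar_im a * scalar_im b).
Proof.
rewrite /scalar_im; case: F a b => //= [a b|[a a'] [b b']] /=; ring.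
Qed.

Section Norm.
Variable V : normedModType K.
Implicit Types x y : V.

Lemma of_real_rnorm x : of_real (rnorm x) = `|x|.
Proof. exact: of_real_ge0. Qed.

Lemma rnorm_ge0 x : 0 <= rnorm x.
Proof. by rewrite -of_real_le of_real_rnorm of_real0. Qed.

Lemma rnorm0 : rnorm (0 : V) = 0.
Proof. by rewrite /rnorm normr0 -of_real0 scalar_re_of_real. Qed.

Lemma rnorm_eq0 x : rnorm x = 0 -> x = 0.
Proof. by move=> x0; apply/normr0_eq0; rewrite -of_real_rnorm x0 of_real0. Qed.

Lemma rnormD x y : rnorm (x + y) <= rnorm x + rnorm y.
Proof. by rewrite -of_real_le of_realD !of_real_rnorm ler_normD. Qed.

Lemma rnormN x : rnorm (- x) = rnorm x.
Proof. by rewrite /rnorm normrN. Qed.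

Lemma rnormZ (a : K) x : rnorm (a *: x) = rnorm (a : K^o) * rnorm x.
Proof.
rewrite -[RHS]scalar_re_of_real of_realM !of_real_rnorm /rnorm normrZ.
by rewrite of_real_ge0.
Qed.

Lemma rnorm_dist x y : `|rnorm x - rnorm y| <= rnorm (x - y).
Proof.
have := rnormD (x - y) y; have := rnormD (y - x) x.
by rewrite !subrK -(rnormN (y - x)) opprB ler_norml => ? ?; apply/andP; split; lra.
Qed.

Lemma rnorm_sum n (v : 'I_n -> V) : rnorm (\sum_i v i) <= \sum_i rnorm (v i).
Proof.
elim/big_ind2 : _ => [|a b c e ab ce|//]; first by rewrite rnorm0.
by apply: le_trans (rnormD _ _) _; exact: lerD.
Qed.

Lemma rnorm_continuous : continuous (@rnorm R F V : V -> R).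
Proof.
move=> x; apply/cvgrPdist_lt => e e0.
have e0' : 0 < (of_real e : K) by rewrite -of_real0 of_real_lt.
near=> y; apply: le_lt_trans (rnorm_dist _ _) _.
rewrite -of_real_lt of_real_rnorm; near: y.
exact: (cvgr_dist_lt id x cvg_id _ e0').
Unshelve. all: by end_near. Qed.

End Norm.

Lemma rnormM (a b : K) : rnorm (a * b : K^o) = rnorm (a : K^o) * rnorm (b : K^o).
Proof. exact: (@rnormZ K^o). Qed.

Lemma rnorm1 : rnorm (1 : K^o) = 1.
Proof. by rewrite /rnorm normr1 -of_real1 scalar_re_of_real. Qed.

Lemma rnorm_sqr (z : K) :
  rnorm (z : K^o) ^+ 2 = scalar_re z ^+ 2 + scalar_im z ^+ 2.
Proof.
rewrite /rnorm /scalar_im; case: F z => /= z; last first.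
  rewrite -[LHS]/(complex.Re (`|z : R[i]|) ^+ 2) normc_def /=.
  by rewrite sqr_sqrtr// addr_ge0// sqr_ge0.
by rewrite real_normK ?num_real// expr0n addr0.
Qed.

Lemma rnorm_of_real (r : R) : rnorm (of_real r : K^o) = `|r|.
Proof.
apply/eqP; rewrite -(@eqrXn2 _ 2)// ?rnorm_ge0//.
by rewrite rnorm_sqr scalar_re_of_real scalar_im_of_real real_normK ?num_real// expr0n addr0.
Qed.

Lemma ler_scalar_re_rnorm (z : K) : `|scalar_re z| <= rnorm (z : K^o).
Proof.
rewrite -(@ler_pXn2r _ 2)// ?nnegrE ?rnorm_ge0//.
by rewrite real_normK ?num_real// rnorm_sqr lerDl sqr_ge0.
Qed.

Lemma ler_scalar_im_rnorm (z : K) : `|scalar_im z| <= rnorm (z : K^o).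
Proof.
rewrite -(@ler_pXn2r _ 2)// ?nnegrE ?rnorm_ge0//.
by rewrite real_normK ?num_real// rnorm_sqr lerDr sqr_ge0.
Qed.

(** This extremality of 1 in the scalar unit disc is why the pairs of a vector
and a functional with pairing 1 form a face in either variable: a convex
combination pairing to 1 forces each of its members to do so. *)
Lemma scalar_disc_extreme1 (t : R) (y z : K) : 0 < t < 1 ->
  rnorm (y : K^o) <= 1 -> rnorm (z : K^o) <= 1 ->
  of_real t * y + of_real (1 - t) * z = 1 -> y = 1 /\ z = 1.
Proof.
move=> /andP[t0 t1] y1 z1 yz.
have := congr1 (@scalar_re R F) yz.
rewrite scalar_reD !scalar_reZ -of_real1 scalar_re_of_real => re1.
have := ler_scalar_re_rnorm y; have := ler_scalar_re_rnorm z.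
rewrite !ler_norml => /andP[_ rz] /andP[_ ry].
have key (w : K) : rnorm (w : K^o) <= 1 -> scalar_re w = 1 -> w = of_real 1.
  move=> w1 rw; rewrite [LHS]scalarE rw.
  suff -> : scalar_im w = 0 by rewrite of_real0 mulr0 addr0.
  apply/eqP; rewrite -sqrf_eq0 eq_le sqr_ge0 andbT.
  have := rnorm_sqr w; rewrite rw; have := rnorm_ge0 (w : K^o); nra.
by split; apply: key => //; nra.
Qed.

Lemma of_real_continuous : continuous (of_real : R -> K).
Proof.
move=> x; apply/cvgrPdist_lt => e e0.
have e0' : 0 < scalar_re e by rewrite -of_real_lt of_real_ge0 ?of_real0// ltW.
near=> y; rewrite -of_realB.
rewrite -(@of_real_rnorm K^o) rnorm_of_real -(of_real_ge0 (ltW e0)) of_real_lt.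
by near: y; exact: (cvgr_dist_lt id x cvg_id _ e0').
Unshelve. all: by end_near. Qed.

(** The disc is a closed part of the continuous image of a square. *)
Lemma scalar_disc_compact (C : R) : compact [set z : K | rnorm (z : K^o) <= C].
Proof.
pose kappa (uv : R * R) : K := of_real uv.1 + scalar_i * of_real uv.2.
have kc : continuous kappa.
  move=> uv; apply: cvgD.
    by apply: (cvg_comp _ of_real); [exact: cvg_fst|exact: of_real_continuous].
  apply: cvgM; first exact: cvg_cst.
  by apply: (cvg_comp _ of_real); [exact: cvg_snd|exact: of_real_continuous].
have sq : compact (`[- C, C]%classic `*` `[- C, C]%classic : set (R * R)).
  by apply: compact_setX; exact: segment_compact.
have kcomp : compact (kappa @` (`[- C, C]%classic `*` `[- C, C]%classic)).
  by apply: continuous_compact => //; exact: continuous_subspaceT.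
apply: (subclosed_compact _ kcomp).
  exact: closed_sublevel (@rnorm_continuous K^o).
move=> z /= zC; exists (scalar_re z, scalar_im z); last by rewrite /kappa -scalarE.
have := le_trans (ler_scalar_re_rnorm z) zC.
have := le_trans (ler_scalar_im_rnorm z) zC.
by rewrite !ler_norml => ? ?; split; rewrite /= in_itv.
Qed.

End Scalars.
Arguments scalar_im {R F}.

(** * Right derivatives and the derivative of a maximum *)

Section RightLimits.
Variable R : realType.
Implicit Types (f g : R -> R) (l c : R).

Lemma right_limit_le f l c e : 0 < e ->
  f s @[s --> 0^'+] --> l -> (forall s, 0 < s -> s <= e -> f s <= c) -> l <= c.
Proof.
move=> e0 fl fc; apply: (closed_cvg (fun x => x <= c)) fl; first exact: closed_le.
near=> s; apply: fc; near: s; first exact: nbhs_right_gt.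
exact: nbhs_right_le.
Unshelve. all: by end_near. Qed.

Lemma right_limit_ge f l c :
  f s @[s --> 0^'+] --> l -> (forall s, 0 < s -> c <= f s) -> c <= l.
Proof.
move=> fl fc; apply: (closed_cvg (fun x => c <= x)) fl; first exact: closed_ge.
by near=> s; apply: fc; near: s; exact: nbhs_right_gt.
Unshelve. all: by end_near. Qed.

Lemma right_derivative_continuous f l :
  (f s - f 0) / s @[s --> 0^'+] --> l -> f s @[s --> 0^'+] --> f 0.
Proof.
move=> fl.
have : (f s - f 0) / s * s + f 0 @[s --> 0^'+] --> l * 0 + f 0.
  apply: cvgD; last exact: cvg_cst.
  by apply: cvgM => //; apply: cvg_at_right_filter; exact: cvg_id.
rewrite mulr0 add0r; apply: cvg_trans; apply: near_eq_cvg; near=> s.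
rewrite divfK ?subrK//; apply: lt0r_neq0; near: s; exact: nbhs_right_gt.
Unshelve. all: by end_near. Qed.

(** Chain rule for a function that has only a right derivative; the difference
quotient factors through the continuous slope function of Caratheodory. *)
Lemma right_derivative_powR f l (q : R) : 0 < f 0 ->
  (f s - f 0) / s @[s --> 0^'+] --> l ->
  (f s `^ q - f 0 `^ q) / s @[s --> 0^'+] --> q * f 0 `^ (q - 1) * l.
Proof.
move=> f0 fl; have [g [gE gc g0]] :
    exists g, [/\ forall z, z `^ q - f 0 `^ q = g z * (z - f 0),
        {for f 0, continuous g} & g (f 0) = q * f 0 `^ (q - 1)].
  exact/is_derive1_caratheodory/is_derive1_powR.
under eq_fun do rewrite gE -mulrA.
apply: cvgM => //; rewrite -g0.
by apply: (cvg_comp f g) gc; exact: right_derivative_continuous fl.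
Qed.

End RightLimits.

(** The directional derivative of a maximum, after Danskin: [h s] is maximised
over a compact set [A], the maximum is [W s], and every [h ^~ z] is convex
along the segments that start at [s = 0], with right derivative [D z] there. *)
Section Danskin.
Variables (R : realType) (Z : topologicalType) (A : set Z).
Variables (h : R -> Z -> R) (W : R -> R) (D : Z -> R).
Hypothesis A_compact : compact A.
Hypothesis h_cont : forall s, continuous (h s).
Hypothesis W_max : forall s, is_maximum [set h s z | z in A] (W s).
Hypothesis h_conv : forall z s t, A z -> 0 <= t <= 1 ->
  h (t * s) z <= t * h s z + (1 - t) * h 0 z.
Hypothesis h_deriv : forall z, A z -> (h s z - h 0 z) / s @[s --> 0^'+] --> D z.

Lemma value_le_max s z : A z -> h s z <= W s.
Proof. by move=> Az; apply: (W_max s).2; exists z. Qed.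

Lemma slope_mono z r s : A z -> 0 < r -> r <= s ->
  (h r z - h 0 z) / r <= (h s z - h 0 z) / s.
Proof.
move=> Az r0 rs; have s0 := lt_le_trans r0 rs.
have rs0 : 0 <= r / s by rewrite divr_ge0 ?ltW.
have rs1 : r / s <= 1 by rewrite ler_pdivrMr// mul1r.
have := @h_conv z s (r / s) Az; rewrite rs0 rs1 divfK ?gt_eqF// => /(_ isT) hr.
rewrite ler_pdivrMr// mulrAC -mulrA; lra.
Qed.

(** By convexity the slopes decrease to the derivative. *)
Lemma derivative_le_slope z s : A z -> 0 < s -> D z <= (h s z - h 0 z) / s.
Proof.
move=> Az s0; apply: right_limit_le s0 (h_deriv Az) _ => r r0 rs.
exact: slope_mono.
Qed.

Lemma max_slope_mono r s : 0 < r -> r <= s -> (W r - W 0) / r <= (W s - W 0) / s.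
Proof.
move=> r0 rs; have s0 := lt_le_trans r0 rs.
have [[z Az <-] _] := W_max r.
have rs0 : 0 <= r / s by rewrite divr_ge0 ?ltW.
have rs1 : r / s <= 1 by rewrite ler_pdivrMr// mul1r.
have := @h_conv z s (r / s) Az; rewrite rs0 rs1 divfK ?gt_eqF// => /(_ isT) hr.
rewrite ler_pdivrMr// mulrAC -mulrA.
have := @value_le_max s z Az; have := @value_le_max 0 z Az; nra.
Qed.

(** By [steepP] these are the maximisers of [h 0] whose derivative is at least
[G]. The present form consists of bounds on continuous functions of [z], which
makes compactness immediate. *)
Definition steep (G : R) : set Z :=
  A `&` [set z | forall s, 0 < s -> W 0 + s * G <= h s z].

Lemma steepP G z : A z -> steep G z <-> h 0 z = W 0 /\ G <= D z.
Proof.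
move=> Az; split=> [[_ zG]|[h0 GD]].
  have h0 : h 0 z = W 0.
    apply/eqP; rewrite eq_le value_le_max//=.
    have lim : h s z - s * G @[s --> 0^'+] --> h 0 z - 0 * G.
      apply: cvgB; first exact: right_derivative_continuous (h_deriv Az).
      apply: cvgM; last exact: cvg_cst.
      by apply: cvg_at_right_filter; exact: cvg_id.
    rewrite mul0r subr0 in lim.
    by apply: right_limit_ge lim _ => s /zG; rewrite lerBrDr.
  split=> //; apply: right_limit_ge (h_deriv Az) _ => s s0.
  by rewrite h0 ler_pdivlMr// lerBrDl mulrC zG.
split=> // s s0; have := derivative_le_slope Az s0.
rewrite h0 ler_pdivlMr// => Dz; rewrite -lerBrDl mulrC.
by apply: le_trans Dz; rewrite ler_pM2r.
Qed.

Lemma steep_compact G : compact (steep G).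
Proof.
apply: compact_closedI => //.
rewrite [X in closed X](_ : _ = \bigcap_(s in [set s | 0 < s])
    [set z | - h s z <= - (W 0 + s * G)]); last first.
  by apply/seteqP; split=> z /= zG s s0; have /= := zG s s0; rewrite lerN2.
apply: closed_bigI => s _; apply: closed_sublevel => z.
exact/continuousN/h_cont.
Qed.

(** The slopes of [W] decrease to some [G] as [s] tends to 0. Let [zeta r] be a
maximiser of [h r]. The chord of [h ^~ (zeta r)] over [[0, r]] starts at or
below [W 0] and ends at [W r >= W 0 + r * G], so beyond [r] its line lies above
[W 0 + s * G], and the convex function lies above that line. The resulting
closed condition [W 0 + s * G <= h s (zeta r)], valid for [r <= s], passes to a
cluster point of [zeta r] as [r] tends to 0, which is therefore steep. *)
Lemma danskin : exists G, [/\ (W s - W 0) / s @[s --> 0^'+] --> G,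
  forall z, A z -> h 0 z = W 0 -> D z <= G & steep G !=set0].
Proof.
pose Q s := (W s - W 0) / s.
have D_le z s : A z -> h 0 z = W 0 -> 0 < s -> D z <= Q s.
  move=> Az h0 s0; apply: le_trans (derivative_le_slope Az s0) _.
  by rewrite h0 ler_pM2r ?invr_gt0// lerB// value_le_max.
have [z0 Az0 z0W] := (W_max 0).1.
have hlb : has_lbound (Q @` [set` `]0, +oo[]).
  exists (D z0) => _ [s + <-]; rewrite /= in_itv/= andbT; exact: D_le.
have QG := @nondecreasing_at_right_cvgr R Q 0 +oo%O isT _ hlb.
have {QG} QG : Q s @[s --> 0^'+] --> inf (Q @` [set` `]0, +oo[]).
  apply: QG => r s; rewrite !in_itv /= !andbT => r0 s0; exact: max_slope_mono.
set G := inf _ in QG; exists G.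
have GQ s : 0 < s -> G <= Q s.
  by move=> s0; apply: ge_inf => //; exists s => //; rewrite /= in_itv/= s0.
split=> // [z Az h0|].
  by apply: right_limit_ge QG _ => s; exact: D_le.
have /choice[zeta zetaP] : forall s, exists z, A z /\ h s z = W s.
  by move=> s; have [[z Az <-] _] := W_max s; exists z.
have [z [Az clz]] : A `&` cluster (zeta @ 0^'+) !=set0.
  apply: A_compact; suff : \forall s \near 0^'+, A (zeta s) by [].
  by apply: nearW => s; exact: (zetaP s).1.
exists z; split=> // s s0.
have cl : closed [set z' | - h s z' <= - (W 0 + s * G)].
  by apply: closed_sublevel => z'; exact/continuousN/h_cont.
suff : [set z' | - h s z' <= - (W 0 + s * G)] z by rewrite /= lerN2.
apply: cl => B zB.
suff [z' [? ?]] : [set z' | - h s z' <= - (W 0 + s * G)] `&` B !=set0.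
  by exists z'.
apply: clz zB.
suff : \forall r \near 0^'+, - h s (zeta r) <= - (W 0 + s * G) by [].
near=> r; rewrite lerN2.
have r0 : 0 < r by near: r; exact: nbhs_right_gt.
have rs : r <= s by near: r; exact: nbhs_right_le.
have [Ar hr] := zetaP r.
have := slope_mono Ar r0 rs; rewrite hr.
have := GQ r r0; rewrite /Q ler_pdivlMr// => Gr.
rewrite ler_pdivlMr// => hs.
have h0 := value_le_max 0 Ar.
suff : s * G <= (W r - h 0 (zeta r)) / r * s - (W 0 - h 0 (zeta r)) by lra.
rewrite (_ : s * G = G * r / r * s); last by rewrite mulfK ?gt_eqF// mulrC.
(* Splits the gain into the part above the slope G and the part due to h 0 < W 0. *)
rewrite -subr_ge0.
have -> : (W r - h 0 (zeta r)) / r * s - (W 0 - h 0 (zeta r)) - G * r / r * s =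
   (W r - W 0 - G * r) * (s / r) + (W 0 - h 0 (zeta r)) * (s / r - 1).
  by field; rewrite gt_eqF.
apply: addr_ge0; apply: mulr_ge0.
- by rewrite subr_ge0.
- by rewrite divr_ge0 ?ltW.
- by rewrite subr_ge0.
- by rewrite subr_ge0 ler_pdivlMr// mul1r.
Unshelve. all: by end_near. Qed.

(** If the values at a steep point are dominated by convex combinations of the
values at two other points, then all the inequalities involved, first
[h 0 <= W 0] and then [D <= G], must be equalities. *)
Lemma steep_face G t z z1 z2 : (forall z, A z -> h 0 z = W 0 -> D z <= G) ->
  0 < t < 1 -> A z1 -> A z2 -> steep G z ->
  (forall s, h s z <= t * h s z1 + (1 - t) * h s z2) -> steep G z1 /\ steep G z2.
Proof.
move=> DG /andP[t0 t1] A1 A2 zG hz; have Az := zG.1.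
have [h0 Dz] := (steepP G Az).1 zG.
have := hz 0; rewrite h0 => hz0.
have w1 := value_le_max 0 A1; have w2 := value_le_max 0 A2.
have h1 : h 0 z1 = W 0 by nra.
have h2 : h 0 z2 = W 0 by nra.
have Dt : D z <= t * D z1 + (1 - t) * D z2.
  rewrite -subr_ge0; pose q z s := (h s z - h 0 z) / s.
  have lim : t * q z1 s + (1 - t) * q z2 s - q z s @[s --> 0^'+] -->
             t * D z1 + (1 - t) * D z2 - D z.
    apply: cvgB; last exact: h_deriv.
    by apply: cvgD; (apply: cvgM; [exact: cvg_cst|exact: h_deriv]).
  apply: right_limit_ge lim _ => s s0.
  have -> : t * q z1 s + (1 - t) * q z2 s - q z s =
            (t * h s z1 + (1 - t) * h s z2 - h s z) / s.
    by rewrite /q h0 h1 h2; field; rewrite gt_eqF.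
  by apply: divr_ge0; [rewrite subr_ge0|exact: ltW].
have D1 := DG _ A1 h1; have D2 := DG _ A2 h2.
by split; apply/steepP => //; split=> //; nra.
Qed.

End Danskin.

(** * Powers of the absolute value *)

Section Powers.
Variables (R : realType) (F : scalar_choice) (p : R).
Local Notation K := (scalar_field R F).
Hypothesis p_gt1 : 1 < p.

Lemma rnorm_powR_convex (t : R) (a b : K) : 0 <= t <= 1 ->
  rnorm (of_real t * a + of_real (1 - t) * b : K^o) `^ p <=
  t * rnorm (a : K^o) `^ p + (1 - t) * rnorm (b : K^o) `^ p.
Proof.
move=> /andP[t0 t1]; have p0 : 0 <= p by apply: ltW; apply: lt_trans p_gt1.
have t1' : 0 <= 1 - t by rewrite subr_ge0.
have le1 : rnorm (of_real t * a + of_real (1 - t) * b : K^o) <=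
    t * rnorm (a : K^o) + (1 - t) * rnorm (b : K^o).
  apply: le_trans (rnormD _ _) _.
  by rewrite !rnormM !rnorm_of_real !ger0_norm.
apply: le_trans (ge0_ler_powR p0 _ _ le1) _; rewrite ?nnegrE ?rnorm_ge0//.
  by rewrite addr_ge0// mulr_ge0// rnorm_ge0.
have := @convex_powR R p (ltW p_gt1) (Itv01 t0 t1) (rnorm (a : K^o)) (rnorm (b : K^o)).
rewrite !inE /= !in_itv /= !rnorm_ge0 => /(_ isT isT).
by rewrite !convRE /=.
Qed.

(** At a zero of [f] continuity needs an argument of its own, since [powR] is 1 on
the negative reals and hence not continuous at 0. *)
Lemma rnorm_powR_continuous (Z : topologicalType) (f : Z -> K) :
  continuous f -> continuous (fun z => rnorm (f z : K^o) `^ p).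
Proof.
have p0 : 0 < p by apply: lt_trans p_gt1.
move=> fc z; have nc : rnorm (f y : K^o) @[y --> z] --> rnorm (f z : K^o).
  apply: (cvg_comp f (fun w : K => rnorm (w : K^o))); first exact: fc.
  exact: (@rnorm_continuous _ _ K^o).
have [fz0|fz0] := eqVneq (rnorm (f z : K^o)) 0; last first.
  apply: (cvg_comp (fun y => rnorm (f y : K^o)) (fun r => r `^ p)) nc _.
  have fz' : rnorm (f z : K^o) \in `]0, +oo[ by rewrite in_itv/= andbT lt_def fz0 rnorm_ge0.
  have /derivable1_diffP/differentiable_continuous := @derivable_powR R 1 p _ fz'.
  exact.
rewrite fz0 in nc; rewrite /continuous_at fz0 powR0 ?gt_eqF//; apply/cvgrPdist_lt => e e0.
near=> y; rewrite sub0r normrN ger0_norm ?powR_ge0//.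
have -> : e = (e `^ p^-1) `^ p by rewrite -powRrM mulVf ?gt_eqF// powRr1// ltW.
apply: gt0_ltr_powR => //; rewrite ?nnegrE ?rnorm_ge0 ?powR_ge0//.
near: y; apply: (cvgr_lt _ nc); exact: powR_gt0.
Unshelve. all: by end_near. Qed.

(** For [a != 0] this is the chain rule applied to |a + s b|^2, a quadratic
polynomial in [s], and the power p / 2. For [a = 0] the quotient is
|b|^p s^(p-1), which tends to 0 because 1 < p. *)
Lemma rnorm_powR_derivative (a b : K) (f := fun s : R => rnorm (a + of_real s * b : K^o) `^ p) :
  (f s - f 0) / s @[s --> 0^'+] -->
  p * scalar_re (scalar_conj a * of_real (rnorm (a : K^o) `^ (p - 2%:R)) * b).
Proof.
have p0 : 0 < p by apply: lt_trans p_gt1.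
rewrite scalar_re_weighted.
have [a0|a0] := eqVneq a 0.
  have r0 : scalar_re (0 : K) = 0 by rewrite -of_real0 scalar_re_of_real.
  have i0 : scalar_im (0 : K) = 0.
    by rewrite -of_real0 scalar_im_of_real.
  rewrite a0 r0 i0 !mul0r addr0 mulr0 mulr0.
  have lim : s `^ (p - 1) * rnorm (b : K^o) `^ p @[s --> 0^'+] --> 0 * rnorm (b : K^o) `^ p.
    by apply: cvgM; [apply: powR_cvg0; rewrite subr_gt0|exact: cvg_cst].
  rewrite mul0r in lim; apply: cvg_trans lim; apply: near_eq_cvg; near=> s.
  have s0 : 0 < s by near: s; exact: nbhs_right_gt.
  rewrite /f a0 !add0r of_real0 mul0r rnorm0 powR0 ?gt_eqF// subr0.
  rewrite rnormM rnorm_of_real gtr0_norm// powRM ?rnorm_ge0 ?(ltW s0)//.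
  by rewrite -(mulr_powRB1 (ltW s0) p0) mulrAC [s * _]mulrC mulfK ?gt_eqF.
pose u s := rnorm (a + of_real s * b : K^o) ^+ 2.
have ua : u 0 = rnorm (a : K^o) ^+ 2 by rewrite /u of_real0 mul0r addr0.
have na : 0 < rnorm (a : K^o).
  by rewrite lt_def rnorm_ge0 andbT; apply: contra_neq a0; exact: rnorm_eq0.
have fE s : f s = u s `^ (p / 2).
  by rewrite /u -powR_mulrn ?rnorm_ge0// -powRrM [2%:R * _]mulrC divfK.
have lim : (u s - u 0) / s @[s --> 0^'+] -->
    2 * (scalar_re a * scalar_re b + scalar_im a * scalar_im b).
  have : 2 * (scalar_re a * scalar_re b + scalar_im a * scalar_im b)
         + s * rnorm (b : K^o) ^+ 2 @[s --> 0^'+] -->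
      2 * (scalar_re a * scalar_re b + scalar_im a * scalar_im b)
         + 0 * rnorm (b : K^o) ^+ 2.
    apply: cvgD; first exact: cvg_cst.
    apply: cvgM; last exact: cvg_cst.
    by apply: cvg_at_right_filter; exact: cvg_id.
  rewrite mul0r addr0; apply: cvg_trans; apply: near_eq_cvg; near=> s.
  have s0 : 0 < s by near: s; exact: nbhs_right_gt.
  rewrite ua /u !rnorm_sqr scalar_reD scalar_imD scalar_reZ scalar_imZ.
  by field; rewrite gt_eqF.
under eq_fun do rewrite !fE.
have u0 : 0 < u 0 by rewrite ua exprn_gt0.
have := @right_derivative_powR R u _ (p / 2) u0 lim.
rewrite [X in _ --> X -> _](_ : _ = p * (rnorm (a : K^o) `^ (p - 2) *
  (scalar_re a * scalar_re b + scalar_im a * scalar_im b)))//.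
rewrite ua -powR_mulrn ?rnorm_ge0// -powRrM (_ : 2%:R * (p / 2 - 1) = p - 2); last by field.
by field.
Unshelve. all: by end_near. Qed.

End Powers.

(** * Finite-dimensional normed spaces and their duals *)

Section Basis.
Variables (R : realType) (F : scalar_choice).
Local Notation K := (scalar_field R F).

Definition combination (V : lmodType K) n (e : 'I_n -> V) (c : 'rV[K]_n) : V :=
  \sum_i c 0 i *: e i.

Lemma combination_is_linear (V : lmodType K) n (e : 'I_n -> V) :
  linear (combination e).
Proof.
move=> a c c'; rewrite /combination scaler_sumr -big_split.
by apply: eq_bigr => i _; rewrite !mxE scalerDl scalerA.
Qed.

Lemma linear_eq0 (V W : lmodType K) (f : V -> W) : linear f -> f 0 = 0.
Proof.
by move=> fl; have /esym/eqP := fl (-1) 0 0; rewrite scaler0 addr0 scaleN1r addNr => /eqP.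
Qed.

Lemma linear_scale (V W : lmodType K) (f : V -> W) a v : linear f -> f (a *: v) = a *: f v.
Proof. by move=> fl; rewrite -[a *: v]addr0 fl (linear_eq0 fl) addr0. Qed.

Lemma linear_opp (V W : lmodType K) (f : V -> W) v : linear f -> f (- v) = - f v.
Proof. by move=> fl; rewrite -scaleN1r (linear_scale _ _ fl) scaleN1r. Qed.

Lemma linear_combination (V W : lmodType K) (f : V -> W) n (e : 'I_n -> V) c :
  linear f -> f (combination e c) = combination (fun i => f (e i)) c.
Proof.
move=> fl; rewrite /combination (big_morph f (id1 := 0) (op1 := +%R)).
- by apply: eq_bigr => i _; exact: linear_scale.
- by move=> u v; rewrite -{1}[u]scale1r fl scale1r.
- exact: linear_eq0.
Qed.

(** A spanning family of minimal length is linearly independent: a nontrivial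
relation would allow one of its members to be dropped. *)
Lemma finite_dimensional_basis (V : lmodType K) : finite_dimensional V ->
  exists (n : nat) (e : 'I_n -> V) (coord : V -> 'rV[K]_n),
    cancel coord (combination e) /\ cancel (combination e) coord.
Proof.
move=> fdV; pose spanning n (e : 'I_n -> V) := forall v, exists c, v = combination e c.
have ex_span : exists n, `[< exists e : 'I_n -> V, spanning n e >].
  have [n [e es]] := fdV; exists n; apply/asboolP; exists e => v.
  have [c ->] := es v; exists (\row_i c i).
  by apply: eq_bigr => i _; rewrite mxE.
have [n /asboolP[e e_span] n_min] := ex_minnP ex_span.
have e_free c : combination e c = 0 -> c = 0.
  move=> ec0; apply/rowP => j; rewrite mxE; apply: contrapT => /eqP cj0.
  case: n e e_span n_min c j ec0 cj0 => [|n] e e_span n_min c j ec0 cj0; first by case: j cj0.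
  suff : (n.+1 <= n)%N by rewrite ltnn.
  apply: n_min; apply/asboolP; exists (fun i => e (lift j i)) => v.
  have [a ->] := e_span v; pose b := a - (a 0 j / c 0 j) *: c.
  exists (\row_i b 0 (lift j i)).
  have -> : combination e a = combination e b.
    rewrite (_ : b = - (a 0 j / c 0 j) *: c + a); last by rewrite scaleNr addrC.
    by rewrite combination_is_linear ec0 scaler0 add0r.
  rewrite /combination (bigD1_ord j)//= [X in X *: e j](_ : b 0 j = 0) ?scale0r ?add0r.
    by apply: eq_bigr => i _; rewrite mxE.
  by rewrite !mxE divfK// subrr.
have [coord coordK] := choice e_span.
exists n, e, coord; split=> [v|c]; first by rewrite -coordK.
apply/eqP; rewrite -subr_eq0; apply/eqP/e_free.
rewrite addrC -scaleN1r combination_is_linear -coordK.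
by rewrite scaleN1r addrC subrr.
Qed.

End Basis.

Section FiniteDimension.
Variables (R : realType) (F : scalar_choice).
Local Notation K := (scalar_field R F).
Variables (X : normedModType K) (n : nat) (e : 'I_n -> X) (coord : X -> 'rV[K]_n).
Hypothesis coordK : cancel coord (combination e).
Hypothesis combK : cancel (combination e) coord.

Lemma coord_linear : linear coord.
Proof.
by move=> a u v; rewrite -{1}(coordK u) -{1}(coordK v) -combination_is_linear combK.
Qed.

Lemma coordP (a : K) u v i : coord (a *: u + v) 0 i = a * coord u 0 i + coord v 0 i.
Proof. by rewrite coord_linear !mxE. Qed.

Lemma sum_continuous (Z : topologicalType) (W : normedModType K) m (f : 'I_m -> Z -> W) :
  (forall i, continuous (f i)) -> continuous (fun z => \sum_i f i z).
Proof.
move=> fc; apply: continuous_big => // ; exact: add_continuous.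
Qed.

Lemma combination_continuous : continuous (combination e).
Proof.
apply: sum_continuous => i c; exact: cvgZr_tmp (@coord_continuous K 1 n 0 i c).
Qed.

(** The coordinates of the vectors of the unit ball are bounded: the norm is
positive, hence bounded below, on a compact set of nonzero coordinate vectors
into which every nonzero vector can be scaled. *)
Lemma coord_bounded : exists C, 0 <= C /\ forall v i, rnorm (coord v 0 i : K^o) <= C * rnorm v.
Proof.
pose len (c : 'rV[K]_n) := \sum_i rnorm (c 0 i : K^o).
have len_cont : continuous len.
  move=> c; apply: (@continuous_big _ _ _ _ _ (@add_continuous R)) => i _ c'.
  apply: (cvg_comp (fun c : 'rV[K]_n => c 0 i) (fun z : K => rnorm (z : K^o))).
    exact: (@coord_continuous K 1 n 0 i).
  exact: (@rnorm_continuous _ _ K^o).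
have len_ge (i : 'I_n) (c : 'rV[K]_n) : rnorm (c 0 i : K^o) <= len c.
  by rewrite /len (bigD1 i)//= lerDl sumr_ge0// => j _; exact: rnorm_ge0.
pose S := [set c : 'rV[K]_n | forall i, rnorm (c ord0 i : K^o) <= 1] `&`
          [set c | - len c <= - 1].
have Sc : compact S.
  apply: compact_closedI; last by apply: closed_sublevel => c; exact/continuousN/len_cont.
  apply: (@rV_compact _ n (fun=> [set z : K | rnorm (z : K^o) <= 1])) => i.
  exact: scalar_disc_compact.
have norm_cont : continuous (fun c => rnorm (combination e c)).
  move=> c; apply: (cvg_comp (combination e) (@rnorm _ _ X)).
    exact: combination_continuous.
  exact: rnorm_continuous.
have scaled v : 0 < len (coord v) ->
    S (of_real (len (coord v))^-1 *: coord v).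
  move=> l0; have nZ i : rnorm ((of_real (len (coord v))^-1 *: coord v) ord0 i : K^o) =
      rnorm (coord v 0 i : K^o) / len (coord v).
    by rewrite mxE rnormM rnorm_of_real ger0_norm ?invr_ge0 ?ltW// mulrC.
  split=> [i|] /=; first by rewrite nZ ler_pdivrMr// mul1r.
  rewrite lerN2 /len; under eq_bigr do rewrite nZ.
  by rewrite -mulr_suml divff// gt_eqF.
have [S0|/set0P Sn0] := eqVneq S set0.
  exists 0; split=> // v i; rewrite mul0r; apply: le_trans (len_ge _ _) _.
  by rewrite leNgt; apply/negP => /scaled; rewrite S0.
have [c0 /set_mem Sc0 c0min] := compact_EVT_min Sn0 Sc (continuous_subspaceT norm_cont).
have m0 : 0 < rnorm (combination e c0).
  rewrite lt_def rnorm_ge0 andbT; apply/eqP => /rnorm_eq0 c00.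
  have : c0 = 0.
    by rewrite -(combK c0) c00 -(combK 0) /combination big1// => i _; rewrite mxE scale0r.
  move=> c0E; move: Sc0.2; rewrite /= c0E /len big1 => [|i _]; last by rewrite mxE rnorm0.
  by rewrite lerN2 leNgt ltr01.
exists (rnorm (combination e c0))^-1; split=> [|v i]; first by rewrite invr_ge0 ltW.
apply: le_trans (len_ge _ _) _.
rewrite mulrC ler_pdivlMr//.
have [l0|l0] := ltrP 0 (len (coord v)); last first.
  by apply: le_trans (rnorm_ge0 _); rewrite pmulr_lle0.
have /mem_set/c0min := scaled v l0.
rewrite -[_ *: _]addr0 combination_is_linear (_ : combination e 0 = 0) ?addr0; last first.
  by rewrite /combination big1// => i' _; rewrite mxE scale0r.
have li0 : 0 <= (len (coord v))^-1 by rewrite invr_ge0 ltW.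
rewrite coordK rnormZ rnorm_of_real (ger0_norm li0).
by rewrite mulrC ler_pdivlMr// mulrC.
Qed.

Definition functional (b : 'rV[K]_n) (x : X) : K^o := \sum_i coord x 0 i * b 0 i.

Lemma functional_linear b : linear (functional b).
Proof.
move=> a u v; rewrite /functional scaler_sumr -big_split.
by apply: eq_bigr => i _; rewrite /= coordP mulrDl -mulrA.
Qed.

Lemma functional_combination b c : functional b (combination e c) = \sum_i c 0 i * b 0 i.
Proof. by rewrite /functional combK. Qed.

Lemma functionalE (f : X -> K^o) : linear f -> functional (\row_i f (e i)) = f.
Proof.
move=> fl; apply/funext => x; rewrite -[in RHS](coordK x) (linear_combination _ _ fl).
by apply: eq_bigr => i _; rewrite mxE.
Qed.

Lemma functional_bounded (f : X -> K^o) : linear f ->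
  exists C, forall x, rnorm (f x) <= C * rnorm x.
Proof.
move=> fl; have [C [C0 HC]] := coord_bounded.
exists (\sum_i C * rnorm (f (e i))) => x.
rewrite -(functionalE fl); apply: le_trans (rnorm_sum _) _.
rewrite mulr_suml; apply: ler_sum => i _.
rewrite rnormM mxE (functionalE fl) mulrAC ler_wpM2r ?rnorm_ge0//.
Qed.

(** Linear maps are bounded in finite dimension, so that the supremum defining
[dual_norm] is a genuine one and bounds the values on the ball; conversely the
pointwise bound makes [f] Lipschitz, hence continuous. *)
Lemma dual_unit_ballP (f : X -> K^o) :
  dual_unit_ball f <-> linear f /\ forall x, rnorm (f x) <= rnorm x.
Proof.
split=> [[[fl _] f1]|[fl f1]].
  split=> // x; have [C HC] := functional_bounded fl.
  have fx_le y : rnorm y <= 1 -> rnorm (f y) <= 1.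
    move=> y1; apply: le_trans f1; apply: ub_le_sup; last by exists y.
    exists `|C| => _ [z z1 <-]; apply: le_trans (HC z) _.
    apply: le_trans (ler_wpM2r (rnorm_ge0 z) (ler_norm C)) _.
    by rewrite ler_piMr// rnorm_ge0.
  have [->|x0] := eqVneq x 0; first by rewrite (linear_eq0 fl) !rnorm0.
  have nx : 0 < rnorm x.
    by rewrite lt_def rnorm_ge0 andbT; apply: contra_neq x0; exact: rnorm_eq0.
  have ni : 0 <= (rnorm x)^-1 by rewrite invr_ge0 ltW.
  have := fx_le (of_real (rnorm x)^-1 *: x).
  rewrite (linear_scale _ _ fl) !rnormZ rnorm_of_real (ger0_norm ni) mulVf ?gt_eqF//.
  by rewrite lexx mulrC ler_pdivrMr// mul1r => /(_ isT).
split; first split=> //.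
  move=> x; apply/cvgrPdist_lt => r r0; near=> y.
  have -> : f x - f y = f (x - y).
    by rewrite [x - y]addrC -[- y]scaleN1r fl scaleN1r addrC.
  apply: (@le_lt_trans _ _ `|x - y|).
    by rewrite -[leLHS]of_real_rnorm -of_real_rnorm of_real_le.
  by near: y; exact: (cvgr_dist_lt id x cvg_id _ r0).
apply: ge_sup; first by exists (rnorm (f 0)); exists 0; rewrite //= /unit_ball /= rnorm0.
by move=> _ [x x1 <-]; exact: le_trans (f1 x) x1.
Unshelve. all: by end_near. Qed.

(** The norm conditions of [Pi_set] relax to unit ball conditions, since
1 = f x <= |f| |x|. The relaxed form is convex in each variable. *)
Lemma Pi_setP (xf : X * (X -> K^o)) :
  Pi_set xf <-> [/\ unit_ball xf.1, dual_unit_ball xf.2 & xf.2 xf.1 = 1].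
Proof.
split=> [[x1 [fd f1] fx]|[x1 fb fx]].
  by split=> //; [rewrite /unit_ball /= x1|split=> //; rewrite f1].
have [fl f_le] := (dual_unit_ballP _).1 fb.
have nfx : rnorm (xf.2 xf.1) = 1 by rewrite fx rnorm1.
split=> //; first by apply/eqP; rewrite eq_le x1 -{1}nfx f_le.
split; first exact: fb.1.
apply/eqP; rewrite eq_le fb.2 /= -{1}nfx; apply: ub_le_sup; last by exists xf.1.
by exists 1 => _ [z z1 <-]; exact: le_trans (f_le z) z1.
Qed.

(** A vector is encoded by its coordinates, a functional by its values on the
basis; this puts [Pi_set] into a space with a product topology, in which the
pairing is a polynomial. *)
Definition Pi_coords : set ('rV[K]_n * 'rV[K]_n) :=
  [set cb | Pi_set (combination e cb.1, functional cb.2)].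

Definition Pi_pair (cb : 'rV[K]_n * 'rV[K]_n) : X * (X -> K^o) :=
  (combination e cb.1, functional cb.2).

Lemma Pi_pair_onto xf : Pi_set xf -> exists2 cb, Pi_coords cb & Pi_pair cb = xf.
Proof.
case: xf => x f xfP; exists (coord x, \row_i f (e i)).
  rewrite /Pi_coords /= coordK functionalE//.
  by have [_ /dual_unit_ballP[]] := (Pi_setP _).1 xfP.
rewrite /Pi_pair /= coordK functionalE//.
by have [_ /dual_unit_ballP[]] := (Pi_setP _).1 xfP.
Qed.

Lemma functional_basis b i : functional b (e i) = b 0 i.
Proof.
have -> : e i = combination e (delta_mx 0 i).
  rewrite /combination (bigD1 i)//= mxE !eqxx scale1r big1 ?addr0// => j ji.
  by rewrite mxE (negbTE ji) andbF scale0r.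
rewrite functional_combination (bigD1 i)//= mxE !eqxx mul1r big1 ?addr0// => j ji.
by rewrite mxE (negbTE ji) andbF mul0r.
Qed.

(** The coordinates of the vector are bounded by [coord_bounded], the value of the
functional at a basis vector by the norm of that vector, and all the defining
conditions are closed. *)
Lemma Pi_coords_compact : compact Pi_coords.
Proof.
have [C [C0 HC]] := coord_bounded.
pose box : set ('rV[K]_n * 'rV[K]_n) :=
  [set c : 'rV[K]_n | forall i, [set z : K | rnorm (z : K^o) <= C] (c ord0 i)] `*`
  [set b : 'rV[K]_n | forall i, [set z : K | rnorm (z : K^o) <= rnorm (e i)] (b ord0 i)].
have box_compact : compact box.
  apply: compact_setX.
    apply: (@rV_compact _ n (fun=> [set z : K | rnorm (z : K^o) <= C])) => i.
    exact: scalar_disc_compact.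
  apply: (@rV_compact _ n (fun i => [set z : K | rnorm (z : K^o) <= rnorm (e i)])) => i.
  exact: scalar_disc_compact.
have fst_cont i : continuous (fun cb : 'rV[K]_n * 'rV[K]_n => cb.1 0 i : K).
  move=> cb; apply: (cvg_comp fst (fun c : 'rV[K]_n => c 0 i)); first exact: cvg_fst.
  exact: (@coord_continuous K 1 n 0 i).
have snd_cont i : continuous (fun cb : 'rV[K]_n * 'rV[K]_n => cb.2 0 i : K).
  move=> cb; apply: (cvg_comp snd (fun c : 'rV[K]_n => c 0 i)); first exact: cvg_snd.
  exact: (@coord_continuous K 1 n 0 i).
have norm_cont (W : normedModType K) (f : 'rV[K]_n * 'rV[K]_n -> W) :
    continuous f -> continuous (fun cb => rnorm (f cb)).
  by move=> fc cb; apply: (cvg_comp f (@rnorm _ _ W)); [exact: fc|exact: rnorm_continuous].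
rewrite (_ : Pi_coords = [set cb | rnorm (combination e cb.1) <= 1] `&`
   (\bigcap_x [set cb | rnorm (functional cb.2 x) <= rnorm x]) `&`
   [set cb | rnorm (functional cb.2 (combination e cb.1) - 1 : K^o) <= 0]); last first.
  apply/seteqP; split=> cb.
    move=> /Pi_setP[x1 /dual_unit_ballP[_ f1] /= fx]; split; first by split=> // x _; exact: f1.
    by rewrite /= fx subrr rnorm0.
  move=> [[x1 f1] /= fx]; apply/Pi_setP; split=> //.
    by apply/dual_unit_ballP; split; [exact: functional_linear|move=> x; exact: f1].
  apply/eqP; rewrite -subr_eq0; apply/eqP/rnorm_eq0/eqP.
  by rewrite eq_le rnorm_ge0 andbT.
apply: (subclosed_compact _ box_compact).
  apply: closedI; first apply: closedI.
  - apply/closed_sublevel/norm_cont; apply: sum_continuous => i cb.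
    exact: cvgZr_tmp (fst_cont i cb).
  - apply: closed_bigI => x _; apply/closed_sublevel/norm_cont.
    apply: sum_continuous => i cb; apply: (@cvgM K); first exact: cvg_cst.
    exact: snd_cont.
  - apply/closed_sublevel/norm_cont => cb; apply: cvgB; last exact: cvg_cst.
    have -> : (fun cb => functional cb.2 (combination e cb.1)) =
        (fun cb : 'rV[K]_n * 'rV[K]_n => \sum_i cb.1 0 i * cb.2 0 i).
      by apply/funext => cb'; rewrite functional_combination.
    rewrite functional_combination; move: cb; apply: (@sum_continuous _ K^o) => i cb.
    by apply: (@cvgM K); [exact: fst_cont|exact: snd_cont].
move=> [c b] [[/= x1 f1] _]; split=> i /=.
  rewrite -(combK c); apply: le_trans (HC _ _) _.
  by rewrite ler_piMr.
by rewrite -functional_basis; exact: f1.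
Qed.

End FiniteDimension.

(** * The derivative of the joint numerical radius *)

Lemma sup_is_maximum (R : realType) (A : set R) m : is_maximum A m -> sup A = m.
Proof.
move=> [Am mA]; apply/eqP; rewrite eq_le ge_sup//=; last by exists m.
by apply: ub_le_sup => //; exists m.
Qed.

Section Main.
Variables (R : realType) (F : scalar_choice).
Local Notation K := (scalar_field R F).

(** A continuous strictly convex function, used to select extreme points. *)
Definition square_length n (c : 'rV[K]_n) : R := \sum_i rnorm (c 0 i : K^o) ^+ 2.

Lemma square_length_continuous n : continuous (@square_length n).
Proof.
apply: continuous_big => [|i _ c]; first exact: add_continuous.
have nc : rnorm ((y : 'rV[K]_n) 0 i : K^o) @[y --> c] --> rnorm (c 0 i : K^o).
  apply: (cvg_comp (fun c : 'rV[K]_n => c 0 i) (fun z : K => rnorm (z : K^o))).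
    exact: (@coord_continuous K 1 n 0 i).
  exact: (@rnorm_continuous _ _ K^o).
exact: (cvgM nc nc).
Qed.

(** From the identity q c = t q c1 + (1 - t) q c2 - t (1 - t) q (c1 - c2). *)
Lemma square_length_strictly_convex n (t : R) (c c1 c2 : 'rV[K]_n) :
  0 < t < 1 -> c = of_real t *: c1 + of_real (1 - t) *: c2 ->
  square_length c1 <= square_length c -> square_length c2 <= square_length c ->
  c1 = c /\ c2 = c.
Proof.
move=> /andP[t0 t1] cE q1 q2.
have qE : square_length c = t * square_length c1 + (1 - t) * square_length c2
    - t * (1 - t) * square_length (c1 - c2).
  rewrite /square_length !mulr_sumr -big_split -sumrB; apply: eq_bigr => i _ /=.
  rewrite cE !mxE !rnorm_sqr !(scalar_reD, scalar_imD, scalar_reZ, scalar_imZ).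
  rewrite -[- c2 0 i]mulN1r -of_real1 -of_realN scalar_reZ scalar_imZ.
  ring.
have q12 : square_length (c1 - c2) <= 0.
  have tt : 0 < t * (1 - t) by rewrite mulr_gt0// subr_gt0.
  have : t * (1 - t) * square_length (c1 - c2) <= 0 by nra.
  by rewrite pmulr_rle0.
have c12 : c1 = c2.
  apply/eqP; rewrite -subr_eq0; apply/eqP/rowP => i; rewrite [RHS]mxE.
  apply: (@rnorm_eq0 _ _ K^o); apply/eqP; rewrite -sqrf_eq0 eq_le sqr_ge0 andbT.
  apply: le_trans q12; rewrite /square_length (bigD1 i)//= lerDl sumr_ge0// => j _.
  exact: sqr_ge0.
by rewrite cE c12 -scalerDl -of_realD addrC subrK of_real1 scale1r.
Qed.

Variables (X : normedModType K) (n : nat) (e : 'I_n -> X) (coord : X -> 'rV[K]_n).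
Hypothesis coordK : cancel coord (combination e).
Hypothesis combK : cancel (combination e) coord.
Variables (d : nat) (p : R).
Hypothesis p_gt1 : 1 < p.

(** The p-th power of [joint_value]. Unlike [joint_value] it is convex by a
termwise argument and differentiable in the operators also where it
vanishes. *)
Definition power_sum (T : 'I_d -> X -> X) (xf : X * (X -> K^o)) : R :=
  \sum_(i < d) rnorm (xf.2 (T i xf.1)) `^ p.

(** The function whose values form [C_set]; by [pencil_sum_derivative] it
is, up to the factor p, the derivative of the power sum. *)
Definition power_slope (T S : 'I_d -> X -> X) (xf : X * (X -> K^o)) : R :=
  \sum_(i < d) scalar_re (scalar_conj (xf.2 (T i xf.1) : K)
     * of_real (rnorm (xf.2 (T i xf.1)) `^ (p - 2%:R)) * xf.2 (S i xf.1)).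

Lemma power_sum_ge0 T xf : 0 <= power_sum T xf.
Proof. by apply: sumr_ge0 => i _; exact: powR_ge0. Qed.

Notation pair := (Pi_pair e coord).

Lemma power_sum_continuous T : (forall i, linear (T i)) ->
  continuous (fun cb => power_sum T (pair cb)).
Proof.
move=> Tl; apply: continuous_big => [|i _]; first exact: add_continuous.
apply: rnorm_powR_continuous => //.
apply: (@sum_continuous R F _ K^o) => k cb.
apply: (@cvgM K); last first.
  apply: (cvg_comp snd (fun b : 'rV[K]_n => b 0 k)); first exact: cvg_snd.
  exact: (@coord_continuous K 1 n 0 k).
have lin : linear (fun x => coord (T i x) 0 k : K^o).
  by move=> a u v; rewrite Tl (coordP coordK combK).
apply: (cvg_comp fst (fun c => coord (T i (combination e c)) 0 k)); first exact: cvg_fst.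
under [X in X @ _ --> _]eq_fun do rewrite (linear_combination _ _ lin).
rewrite (linear_combination _ _ lin).
exact: (@combination_continuous R F K^o).
Qed.

Lemma power_sum_maximum T : (forall i, linear (T i)) -> Pi_coords e coord !=set0 ->
  exists w, is_maximum [set power_sum T (pair cb) | cb in Pi_coords e coord] w.
Proof.
move=> Tl ne.
have [cb /set_mem cbP cbmax] := compact_EVT_max ne
  (Pi_coords_compact coordK combK) (continuous_subspaceT (power_sum_continuous Tl)).
exists (power_sum T (pair cb)); split; first by exists cb.
by move=> _ [cb' cb'P <-]; apply: cbmax; exact: mem_set.
Qed.

Lemma joint_radiusE T w :
  is_maximum [set power_sum T (pair cb) | cb in Pi_coords e coord] w ->
  joint_radius p T = w `^ p^-1.
Proof.
have p0 : 0 < p by exact: lt_trans p_gt1.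
move=> [[cb cbP <-] wmax]; apply: sup_is_maximum; split; first by exists (pair cb).
move=> _ [xf /(Pi_pair_onto coordK combK)[cb' cb'P <-] <-].
apply: ge0_ler_powR; rewrite ?nnegrE ?power_sum_ge0 ?invr_ge0 ?(ltW p0)//.
by apply: wmax; exists cb'.
Qed.

Lemma power_sum_convex (T T1 T2 : 'I_d -> X -> X) xf xf1 xf2 t : 0 <= t <= 1 ->
  (forall i, xf.2 (T i xf.1) =
     of_real t * xf1.2 (T1 i xf1.1) + of_real (1 - t) * xf2.2 (T2 i xf2.1)) ->
  power_sum T xf <= t * power_sum T1 xf1 + (1 - t) * power_sum T2 xf2.
Proof.
move=> t01 Txf; rewrite /power_sum !mulr_sumr -big_split; apply: ler_sum => i _ /=.
by rewrite Txf; exact: rnorm_powR_convex.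
Qed.

Variables T S : 'I_d -> X -> X.
Hypothesis T_linear : forall i, linear (T i).
Hypothesis S_linear : forall i, linear (S i).

Definition pencil (s : R) : 'I_d -> X -> X := T + (of_real s : K) *: S.

Lemma pencil_linear s i : linear (pencil s i).
Proof.
move=> a u v; rewrite -[LHS]/(T i (a *: u + v) + of_real s *: S i (a *: u + v)).
rewrite T_linear S_linear scalerDr addrACA scalerA mulrC -scalerA -scalerDr.
by [].
Qed.

Lemma pencil0 : pencil 0 = T.
Proof. by rewrite /pencil of_real0 scale0r addr0. Qed.

Lemma functional_pencil b s i x :
  functional coord b (pencil s i x) =
  functional coord b (T i x) + of_real s * functional coord b (S i x).
Proof.
rewrite -[pencil s i x]/(T i x + of_real s *: S i x) addrC.
by rewrite (functional_linear coordK combK) addrC.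
Qed.

Definition pencil_sum s cb := power_sum (pencil s) (pair cb).

Lemma pencil_sum_convex cb s t : 0 <= t <= 1 ->
  pencil_sum (t * s) cb <= t * pencil_sum s cb + (1 - t) * pencil_sum 0 cb.
Proof.
move=> t01; apply: power_sum_convex => // i /=.
rewrite !functional_pencil of_real0 of_realM of_realB of_real1; ring.
Qed.

Lemma pencil_sum_derivative cb :
  (pencil_sum s cb - pencil_sum 0 cb) / s @[s --> 0^'+] --> p * power_slope T S (pair cb).
Proof.
rewrite /power_slope mulr_sumr.
under eq_fun do rewrite /pencil_sum /power_sum -sumrB mulr_suml.
apply: cvg_big => [|i _]; first exact: add_continuous.
under eq_fun do rewrite /= !functional_pencil.
exact: rnorm_powR_derivative.
Qed.


Local Notation A := (Pi_coords e coord).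

Lemma coord_combination_convex t (y z : X) :
  coord (of_real t *: y + of_real (1 - t) *: z) =
  of_real t *: coord y + of_real (1 - t) *: coord z.
Proof.
by rewrite (coord_linear coordK combK) (linear_scale _ _ (coord_linear coordK combK)).
Qed.

Lemma scalar_between (t : K) : 0 < t -> t < 1 ->
  exists2 r : R, 0 < r < 1 & t = of_real r /\ 1 - t = of_real (1 - r).
Proof.
move=> t0 t1; have tE := of_real_ge0 (ltW t0).
exists (scalar_re t); last by rewrite of_realB of_real1 tE.
by rewrite -!(of_real_lt F) of_real0 of_real1 tE t0.
Qed.

Lemma pairing_face (t : R) (y z : X) (g k : X -> K^o) : 0 < t < 1 ->
  unit_ball y -> unit_ball z -> dual_unit_ball g -> dual_unit_ball k ->
  of_real t * g y + of_real (1 - t) * k z = 1 -> g y = 1 /\ k z = 1.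
Proof.
move=> t01 y1 z1 /(dual_unit_ballP coordK combK)[_ g1] /(dual_unit_ballP coordK combK)[_ k1].
apply: (scalar_disc_extreme1 t01); first exact: le_trans (g1 y) y1.
exact: le_trans (k1 z) z1.
Qed.

(** A point of a face that maximises a strictly convex function over the face is
extreme. The face property of [P] is applied to segments along which only the
vector, or only the functional, varies, and the pair [cb] serves both: a
maximiser over [P] is in particular one in each variable separately. *)
Lemma extreme_of_face (P : set ('rV[K]_n * 'rV[K]_n)) cb : P `<=` A ->
  (forall t z z1 z2, 0 < t < 1 -> A z1 -> A z2 -> P z ->
    (forall s, pencil_sum s z <= t * pencil_sum s z1 + (1 - t) * pencil_sum s z2) ->
    P z1 /\ P z2) ->
  P cb ->
  (forall z, P z -> square_length z.1 + square_length z.2 <=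
                    square_length cb.1 + square_length cb.2) ->
  extreme_points (@unit_ball R F X) (pair cb).1 /\
  extreme_points (@dual_unit_ball R F X) (pair cb).2.
Proof.
case: cb => c b PA face Pcb max_cb.
have [x1 fb fx] := (Pi_setP coordK combK _).1 (PA _ Pcb); rewrite /= in x1 fb fx.
have le1 (r : R) : 0 < r < 1 -> 0 <= r <= 1 by move=> /andP[/ltW-> /ltW->].
have fl := functional_linear coordK combK b.
split; split=> //=.
  move=> y z t y1 z1 t0 t1.
  have [r r01 [-> ->]] := scalar_between t0 t1 => xE.
  have fE w w' : functional coord b (of_real r *: w + of_real (1 - r) *: w') =
      of_real r * functional coord b w + of_real (1 - r) * functional coord b w'.
    by rewrite fl (linear_scale _ _ fl).
  have [fy fz] : functional coord b y = 1 /\ functional coord b z = 1.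
    by apply: (pairing_face r01 y1 z1 fb fb); rewrite -fE -xE.
  have Ay : A (coord y, b) by apply/(Pi_setP coordK combK); rewrite /= coordK.
  have Az : A (coord z, b) by apply/(Pi_setP coordK combK); rewrite /= coordK.
  have [|Py Pz] := face r _ _ _ r01 Ay Az Pcb.
    move=> s; apply: power_sum_convex => //=; first exact: le1.
    move=> i; rewrite !coordK xE -fE; congr (functional _ _ _).
    by rewrite pencil_linear (linear_scale _ _ (@pencil_linear s i)).
  have [cy cz] : coord y = c /\ coord z = c.
    apply: (square_length_strictly_convex r01).
    - by rewrite -coord_combination_convex -xE combK.
    - by rewrite -(lerD2r (square_length b)); exact: max_cb Py.
    - by rewrite -(lerD2r (square_length b)); exact: max_cb Pz.
  by rewrite -(coordK y) -(coordK z) cy cz.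
move=> g k t g1 k1 t0 t1.
have [r r01 [-> ->]] := scalar_between t0 t1 => fE.
have [[gl _] [kl _]] := ((dual_unit_ballP coordK combK _).1 g1,
                         (dual_unit_ballP coordK combK _).1 k1).
have fEx w : functional coord b w = of_real r * g w + of_real (1 - r) * k w.
  by rewrite fE.
have [gx kx] : g (combination e c) = 1 /\ k (combination e c) = 1.
  by apply: (pairing_face r01 x1 x1 g1 k1); rewrite -fEx.
have gE := functionalE coordK gl; have kE := functionalE coordK kl.
pose bg : 'rV[K]_n := \row_i g (e i); pose bk : 'rV[K]_n := \row_i k (e i).
have Ag : A (c, bg) by apply/(Pi_setP coordK combK); rewrite /= gE.
have Ak : A (c, bk) by apply/(Pi_setP coordK combK); rewrite /= kE.
have [|Pg Pk] := face r _ _ _ r01 Ag Ak Pcb.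
  move=> s; apply: power_sum_convex => //=; first exact: le1.
  by move=> i; rewrite gE kE fEx.
have [bgE bkE] : bg = b /\ bk = b.
  apply: (square_length_strictly_convex r01).
  - apply/rowP => i; rewrite !mxE -(functional_basis combK) fEx.
    by [].
  - by rewrite -(lerD2l (square_length c)); exact: max_cb Pg.
  - by rewrite -(lerD2l (square_length c)); exact: max_cb Pk.
by rewrite -gE -kE -/bg -/bk bgE bkE.
Qed.

Hypothesis Pi_neq0 : exists2 xf : X * (X -> K^o), Pi_set xf &
  exists i, xf.2 (T i xf.1) != 0.

(** The set of steep pairs is a nonempty compact face, and it has a point with both
components extreme. This point realises the derivative [G] of the maximal
power sum as [p] times an element of [C_set], while no element can exceed
[G / p]; the p-th root is then taken with the chain rule. *)
Lemma joint_derivative : exists M,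
  is_maximum (C_set p T S) M /\
  is_Gplus p T S (1 / joint_radius p T `^ (p - 1) * M).
Proof.
have p0 : 0 < p by exact: lt_trans p_gt1.
have [xf0 xf0P [i0 Ti0]] := Pi_neq0.
have [cb0 cb0P cb0E] := Pi_pair_onto coordK combK xf0P.
have A0 : A !=set0 by exists cb0.
have /choice[W Wmax] s := power_sum_maximum (pencil_linear s) A0.
have radiusE s : joint_radius p (pencil s) = W s `^ p^-1 by exact: joint_radiusE.
have rT : joint_radius p T = W 0 `^ p^-1 by rewrite -radiusE pencil0.
have W0 : 0 < W 0.
  apply: (@lt_le_trans _ _ (power_sum T xf0)); last first.
    by apply: (Wmax 0).2; exists cb0 => //; rewrite pencil0 cb0E.
  rewrite /power_sum (bigD1 i0)//= ltr_pwDl ?sumr_ge0// => [|i _]; last exact: powR_ge0.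
  by apply: powR_gt0; rewrite lt_def rnorm_ge0 andbT; apply: contra_neq Ti0; exact: rnorm_eq0.
have Ac := Pi_coords_compact coordK combK.
have hc s : continuous (pencil_sum s) by exact: power_sum_continuous (pencil_linear s).
have hconv z s t : A z -> 0 <= t <= 1 ->
    pencil_sum (t * s) z <= t * pencil_sum s z + (1 - t) * pencil_sum 0 z.
  by move=> _; exact: pencil_sum_convex.
have hder z : A z ->
    (pencil_sum s z - pencil_sum 0 z) / s @[s --> 0^'+] --> p * power_slope T S (pair z).
  by move=> _; exact: pencil_sum_derivative.
have [G [WG DG stG]] := danskin Ac hc Wmax hconv hder.
have attainE z : A z ->
    joint_value p T (pair z) = joint_radius p T <-> pencil_sum 0 z = W 0.
  move=> Az; rewrite /pencil_sum pencil0 rT; split=> [|<-//].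
  apply: powR_injective; rewrite ?invr_gt0 ?nnegrE ?power_sum_ge0 ?(ltW W0)//.
have lc : continuous (fun cb : 'rV[K]_n * 'rV[K]_n => square_length cb.1 + square_length cb.2).
  move=> cb; apply: cvgD; apply: (cvg_comp _ (@square_length n)).
  - exact: cvg_fst.
  - exact: square_length_continuous.
  - exact: cvg_snd.
  - exact: square_length_continuous.
have [cb /set_mem cbG cbmax] := compact_EVT_max stG
  (@steep_compact _ _ A pencil_sum W Ac hc G) (continuous_subspaceT lc).
have [cb_x cb_f] : extreme_points (@unit_ball R F X) (pair cb).1 /\
                   extreme_points (@dual_unit_ball R F X) (pair cb).2.
  apply: (extreme_of_face (P := steep A pencil_sum W G)) => //.
  - by move=> z [].
  - by move=> t z z1 z2 t01 A1 A2 zG hz; exact: (steep_face Wmax hconv hder DG t01 A1 A2 zG hz).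
  - by move=> z zG; apply: cbmax; exact: mem_set.
have Acb := cbG.1.
have [hcb Dcb] := (steepP Wmax hconv hder G Acb).1 cbG.
exists (G / p); split; first split.
- exists (pair cb); first by split=> //; split=> //; exact/attainE.
  have -> : G = p * power_slope T S (pair cb) by apply/eqP; rewrite eq_le Dcb DG.
  by rewrite mulrC mulKf ?gt_eqF.
- move=> _ [xf [[xfP att] _ _] <-].
  have [z Az zE] := Pi_pair_onto coordK combK xfP.
  have hz : pencil_sum 0 z = W 0 by apply/attainE => //; rewrite zE.
  by rewrite ler_pdivlMr// mulrC -zE; exact: DG.
have := right_derivative_powR (q := p^-1) W0 WG.
rewrite /is_Gplus /gateaux_quotient.
rewrite [X in _ --> X -> _](_ : _ = 1 / joint_radius p T `^ (p - 1) * (G / p)); last first.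
  rewrite rT -powRrM div1r -powRN (_ : - (p^-1 * (p - 1)) = p^-1 - 1); last first.
    by field; rewrite gt_eqF.
  ring.
rewrite [X in X @ _ --> _ -> _](_ : _ = fun s =>
  (joint_radius p (T + (of_real s : K) *: S) - joint_radius p T) / s)//.
by apply/funext => s; rewrite -!radiusE pencil0.
Qed.

End Main.

Theorem corollary3p2 (R : realType) (F : scalar_choice)
  (X : completeNormedModType (scalar_field R F))
  (w_is_norm : is_norm_on (bounded_operators X X) numerical_radius)
  (X_finite_dim : finite_dimensional X)
  (d : nat) (d_ge1 : (1 <= d)%N)
  (p : R) (p_gt1 : 1 < p)
  (T S : 'I_d -> X -> X)
  (T_bounded : forall i, bounded_operators X X (T i))
  (S_bounded : forall i, bounded_operators X X (S i))
  (T_neq0 : T <> 0) :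
  exists M m : R,
    [/\ is_maximum (C_set p T S) M,
        is_minimum (C_set p T S) m,
        is_Gplus p T S (1 / joint_radius p T `^ (p - 1) * M)
      & is_Gminus p T S (1 / joint_radius p T `^ (p - 1) * m)].
Proof.
have [n [e [coord [coordK combK]]]] := finite_dimensional_basis X_finite_dim.
have Tl i : linear (T i) by have [] := T_bounded i.
have Sl i : linear (S i) by have [] := S_bounded i.
have NSE i x : (- S) i x = - S i x by [].
have NSl i : linear ((- S) i).
  by move=> a u v; rewrite !NSE Sl opprD scalerN.
(* The supremum of an empty set is 0, so the norm property of the numerical radius
   provides a pair at which T does not vanish, and in particular some pair. *)
have Pi_neq0 : exists2 xf : X * (X -> (scalar_field R F)^o), Pi_set xf &
    exists i, xf.2 (T i xf.1) != 0.
  apply: contrapT => nex; apply: T_neq0; apply/funext => i.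
  have [_ w_def _ _] := w_is_norm; apply: w_def => //.
  have all0 xf : Pi_set xf -> rnorm (xf.2 (T i xf.1)) = 0.
    move=> xfP; have [->|neq] := eqVneq (xf.2 (T i xf.1)) 0; first exact: rnorm0.
    by case: nex; exists xf => //; exists i.
  rewrite /numerical_radius; have [->|/set0P[xf xfP]] := eqVneq (@Pi_set R F X) set0.
    by rewrite image_set0 sup0.
  apply: sup_is_maximum; split; first by exists xf; rewrite ?all0.
  by move=> _ [xf' /all0 xf'0 <-]; rewrite xf'0.
have [M [Mmax MG]] := joint_derivative coordK combK p_gt1 Tl Sl Pi_neq0.
(* The left derivative towards S is minus the right derivative towards - S. *)
have [m [mmax mG]] := joint_derivative coordK combK p_gt1 Tl NSl Pi_neq0.
have slopeN xf : Pi_set xf -> power_slope p T (- S) xf = - power_slope p T S xf.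
  move=> [_ [[fl _] _] _]; rewrite /power_slope -sumrN; apply: eq_bigr => i _.
  have -> : xf.2 ((- S) i xf.1) = - xf.2 (S i xf.1).
    by rewrite NSE; exact: linear_opp fl.
  by rewrite mulrN -mulN1r -of_real1 -of_realN scalar_reZ mulN1r.
exists M, (- m); split=> //.
  split.
    have [[xf xfP xfm] _] := mmax; have [[Pxf _] _ _] := xfP; exists xf => //.
    apply: etrans (congr1 -%R xfm).
    by apply: etrans (congr1 -%R (esym (slopeN _ Pxf))); rewrite opprK.
  move=> _ [xf xfP <-]; have [[Pxf _] _ _] := xfP; rewrite lerNl.
  by apply: mmax.2; exists xf => //; exact: slopeN.
rewrite /is_Gminus; apply/cvg_at_leftNP; rewrite oppr0 mulrN.
have TS t : T + (of_real (- t) : scalar_field R F) *: S =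
            T + (of_real t : scalar_field R F) *: (- S).
  by rewrite of_realN scaleNr scalerN.
have -> : gateaux_quotient p T S \o -%R = (fun t => - gateaux_quotient p T (- S) t).
  by apply/funext => t; rewrite /gateaux_quotient [LHS]/= TS invrN mulrN.
exact: cvgN mG.
Qed.
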